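(* Consider the submodular online bipartite matching problem with matroid constraints and free disposal (defined in the context), with set of agents $\Lambda$. Suppose algorithm $\mathrm{MULTI}$ is run such that each agent $\lambda\in\Lambda$ uses as its subroutine $\mathcal{G}^\lambda$ the algorithm $\mathrm{MAT}$ for general matroids or the algorithm $\mathrm{UNI}_k$ for $k$-uniform matroids. Then, if each $\mathcal{G}^\lambda$ has competitive ratio at least $\frac1\alpha$, then $\mathrm{MULTI}$ has competitive ratio at least $\frac1{\alpha+1}$; that is, at the end of every finite sequence of items, the final sets satisfy $$\sum_{\lambda\in\Lambda}f^\lambda(S^\lambda)\ge\frac1{\alpha+1}\sum_{\lambda\in\Lambda}f^\lambda(\mathsf{OPT}^\lambda),$$ where $(\mathsf{OPT}^\lambda)_{\lambda\in\Lambda}$ is an optimal offline assignment.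
   Context: Problem: each agent $\lambda\in\Lambda$ has a non-negative monotone submodular function $f^\lambda:2^\Omega\to\mathbb{R}_+$ and a matroid $(\Omega,\mathcal{I}^\lambda)$ in which every singleton is independent. Each agent maintains $S^\lambda\in\mathcal{I}^\lambda$, initially empty. Distinct items $u\in\Omega$ arrive one by one in a finite sequence; when $u$ arrives, it is either discarded or assigned to one agent $\lambda$, in which case $u$ is included in $S^\lambda$ and some element might have to be removed from $S^\lambda$ so that $S^\lambda\in\mathcal{I}^\lambda$; discarded or removed items cannot be retrieved. The goal is to maximize $\sum_\lambda f^\lambda(S^\lambda)$. An offline assignment is a family of pairwise disjoint sets $\mathsf{OPT}^\lambda\in\mathcal{I}^\lambda$ of items of the sequence, optimal if it maximizes $\sum_\lambda f^\lambda(\mathsf{OPT}^\lambda)$. Competitive ratio of a single-agent algorithm: the single-agent problem is the case of one agent, with monotone submodular $f:2^\Omega\to\mathbb{R}_+$ and matroid $(\Omega,\mathcal{I})$. A (deterministic) online algorithm for it has competitive ratio $r\le1$ if, at the end of every finite sequence of elements, the set $S$ it maintains satisfies $f(S)\ge r\cdot f(\mathsf{OPT})$, where $\mathsf{OPT}$ is an independent set of elements of the sequence maximizing $f$. Each $\mathcal{G}^\lambda$ is such an algorithm with respect to $f^\lambda$ and $\mathcal{I}^\lambda$. Notation for a single agent (superscript $\lambda$ suppressed): $S+a:=S\cup\{a\}$, $S-a:=S\setminus\{a\}$, $f(a|S):=f(S+a)-f(S)$. $A$ is the set of all elements ever added to $S$; $A(u)$ is the set $A$ at the beginning of the round in which $u$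 arrives; $w(u):=f(u|A(u))$; for the current $S$, $w_S(v):=f(v|A(v)\cap S)$. For a weight function $\omega$, $\omega(T):=\sum_{v\in T}\omega(v)$. Also $S-\bot:=S$ and $w_S(\bot):=0$ for a dummy element $\bot$. $\mathrm{UNI}_k$ (for the $k$-uniform matroid, whose independent sets are the sets of cardinality at most $k$, with $k\ge4$): $\alpha_k$ is the unique root in $(3,4)$ of $a=\left(1+\frac{a-2}{k+1}\right)^{k+1}$. Start with $S=A=\varnothing$. When $u$ arrives, accept $u$ iff $w(u)>\frac1k\left(\alpha_k w_S(S)-w(A)\right)$; if accepted, let $u'\in\arg\min_{v\in S}w_S(v)$ if $|S|=k$ and $u'=\bot$ if $|S|<k$, and set $S\leftarrow S-u'+u$, $A\leftarrow A+u$. $\mathrm{MAT}$: start with $S=A=\varnothing$. When $u$ arrives: if $S+u\in\mathcal{I}$ and $w(u)>0$, accept $u$ with $u'=\bot$. Otherwise let $T:=\{v\in S:S-v+u\in\mathcal{I}\}$ and $u'\in\arg\min_{v\in T}w_S(v)$ (discard $u$ if $T=\varnothing$), and accept $u$ iff $w(u)\ge2w_S(u')$. If accepted, set $S\leftarrow S-u'+u$ and $A\leftarrow A+u$. $\mathrm{MULTI}$: when $u$ arrives, pass $u$ to each $\mathcal{G}^\lambda$ with its current $S^\lambda,A^\lambda$. Let $L(u)$ be the set of pairs $(\lambda,v^\lambda)$ for which $\mathcal{G}^\lambda$ would accept $u$ and remove $v^\lambda$ from $S^\lambda$ ($v^\lambda=\bot$ if nothing would be removed), without updating yet. If $L(u)\ne\varnothing$,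 choose $(\lambda,v^\lambda)\in L(u)$ maximizing $w^\lambda(u)-w^\lambda_{S^\lambda}(v^\lambda)$ (ties arbitrary), and for this $\lambda$ only set $S^\lambda\leftarrow S^\lambda+u-v^\lambda$ and $A^\lambda\leftarrow A^\lambda+u$. If $L(u)=\varnothing$, discard $u$.
   Formalization: ''Competitive ratio at least 1/α'' for each subroutine is taken as a guarantee for all non-negative monotone submodular objectives on the agent's matroid (fixed tie-breaking), not just for the agent's own objective; with the latter alone the claim is false. *)

(* Defs.v *)
From HB Require Import structures.
From mathcomp Require Import all_boot all_order all_algebra finmap.
From mathcomp Require Import reals.

Set Implicit Arguments.
Unset Strict Implicit.
Unset Printing Implicit Defensive.

Import Order.TTheory GRing.Theory Num.Theory.

Local Open Scope fset_scope.
Local Open Scope ring_scope.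

(* The ground set is an arbitrary choiceType T, finite or not. Item sequences
   are finite, so only finite sets of items ever occur, and objectives and
   independence are given on {fset T}; for a finite T this is all of 2^T. *)

Definition monotone_submodular (R : realType) (T : choiceType)
    (f : {fset T} -> R) : Prop :=
  [/\ forall X, 0 <= f X,
      forall X Y, X `<=` Y -> f X <= f Y
    & forall X Y, f (X `|` Y) + f (X `&` Y) <= f X + f Y].

Definition matroid (T : choiceType) (I : pred {fset T}) : Prop :=
  [/\ I fset0,
      forall X Y, X `<=` Y -> I Y -> I X
    & forall X Y, I X -> I Y -> (#|` X| < #|` Y|)%N ->
        exists2 y, y \in Y `\` X & I (y |` X)].

(* cur is the maintained set S; hist lists, in order of arrival, the set A of
   all items ever added to S. *)
Record state (T : choiceType) := State { cur : {fset T}; hist : seq T }.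

Definition init_state (T : choiceType) : state T := State fset0 [::].

Definition marginal (R : realType) (T : choiceType) (f : {fset T} -> R)
    (u : T) (X : {fset T}) : R :=
  f (u |` X) - f X.

(* A(u): the items of A that precede u. For an item that is not in A, such as
   the one arriving in the current round, index returns the size of A and this
   is the whole of A. *)
Definition hist_before (T : choiceType) (st : state T) (u : T) : {fset T} :=
  [fset x in take (index u (hist st)) (hist st)].

Definition weight (R : realType) (T : choiceType) (f : {fset T} -> R)
    (st : state T) (u : T) : R :=
  marginal f u (hist_before st u).

Definition cur_weight (R : realType) (T : choiceType) (f : {fset T} -> R)
    (st : state T) (v : T) : R :=
  marginal f v (hist_before st v `&` cur st).

(* The dummy element is None. *)
Definition cur_weight_opt (R : realType) (T : choiceType) (f : {fset T} -> R)
    (st : state T) (v : option T) : R :=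
  if v is Some x then cur_weight f st x else 0.

(* S - v + u and A + u. *)
Definition update (T : choiceType) (st : state T) (u : T) (v : option T) :
    state T :=
  State (u |` (if v is Some x then cur st `\ x else cur st))
        (rcons (hist st) u).

Definition argmin_cur_weight (R : realType) (T : choiceType)
    (f : {fset T} -> R) (st : state T) (C : {fset T}) : {fset T} :=
  [fset v in C | all (fun x => cur_weight f st v <= cur_weight f st x) C].

(* Which minimizer is removed is left open by the algorithms. A tie-breaking
   rule makes them deterministic: it selects an item from the set of
   minimizers, possibly looking at the state and at the arriving item. *)
Definition tie_rule (T : choiceType) := state T -> T -> {fset T} -> T.

Definition valid_tie_rule (T : choiceType) (tb : tie_rule T) : Prop :=
  forall st u C, C != fset0 -> tb st u C \in C.

(* A decision is None if u is discarded, and Some v if u is accepted and v is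
   removed, where v = None if nothing is removed. *)
Definition mat_decision (R : realType) (T : choiceType) (f : {fset T} -> R)
    (I : pred {fset T}) (tb : tie_rule T) (st : state T) (u : T) :
    option (option T) :=
  if I (u |` cur st) && (0 < weight f st u) then Some None
  else
    let C := [fset v in cur st | I (u |` (cur st `\ v))] in
    if C == fset0 then None
    else
      let v := tb st u (argmin_cur_weight f st C) in
      if 2 * cur_weight f st v <= weight f st u then Some (Some v) else None.

Definition uni_decision (R : realType) (T : choiceType) (f : {fset T} -> R)
    (k : nat) (a : R) (tb : tie_rule T) (st : state T) (u : T) :
    option (option T) :=
  if k%:R^-1 * (a * (\sum_(v <- cur st) cur_weight f st v)
                - \sum_(v <- hist st) weight f st v) < weight f st u
  then
    Some (if (#|` cur st| < k)%N then None
          else Some (tb st u (argmin_cur_weight f st (cur st))))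
  else None.

(* The real parameter of UNI stands for alpha_k; see valid_algorithm. *)
Inductive algorithm (R : realType) : Type :=
| MAT
| UNI of nat & R.

Arguments MAT {R}.

Definition is_alpha (R : realType) (k : nat) (a : R) : Prop :=
  3 < a < 4 /\ a = (1 + (a - 2) / k.+1%:R) ^+ k.+1.

Definition valid_algorithm (R : realType) (T : choiceType)
    (G : algorithm R) (I : pred {fset T}) : Prop :=
  match G with
  | MAT => True
  | UNI k a =>
      [/\ (4 <= k)%N, is_alpha k a & forall X, I X = (#|` X| <= k)%N]
  end.

Definition decision (R : realType) (T : choiceType) (G : algorithm R)
    (f : {fset T} -> R) (I : pred {fset T}) (tb : tie_rule T)
    (st : state T) (u : T) : option (option T) :=
  match G with
  | MAT => mat_decision f I tb st u
  | UNI k a => uni_decision f k a tb st u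
  end.

Definition single_run (R : realType) (T : choiceType) (G : algorithm R)
    (f : {fset T} -> R) (I : pred {fset T}) (tb : tie_rule T) (s : seq T) :
    state T :=
  foldl (fun st u => if decision G f I tb st u is Some v then update st u v
                     else st)
        (init_state T) s.

Definition is_opt (R : realType) (T : choiceType) (f : {fset T} -> R)
    (I : pred {fset T}) (s : seq T) (O : {fset T}) : Prop :=
  [/\ {subset O <= s}, I O
    & forall X : {fset T}, {subset X <= s} -> I X -> f X <= f O].

(* A competitive ratio is a worst-case guarantee of an algorithm over the
   instances of the single-agent problem. The objective is part of the
   instance (an algorithm only queries it), hence the quantification over g;
   the ground set and the matroid are those of the agent. A guarantee for the
   agent's own objective alone would not imply a guarantee for MULTI. *)
Definition has_competitive_ratio (R : realType) (T : choiceType)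
    (G : algorithm R) (I : pred {fset T}) (tb : tie_rule T) (r : R) : Prop :=
  forall g : {fset T} -> R, monotone_submodular g ->
  forall s : seq T, uniq s ->
  forall O : {fset T}, is_opt g I s O ->
  r * g O <= g (cur (single_run G g I tb s)).

(* One round of MULTI; a relation, because ties between agents are broken
   arbitrarily. *)
Definition multi_step (R : realType) (T : choiceType) (Lam : finType)
    (G : Lam -> algorithm R) (f : Lam -> {fset T} -> R)
    (I : Lam -> pred {fset T}) (tb : Lam -> tie_rule T)
    (st : Lam -> state T) (u : T) (st' : Lam -> state T) : Prop :=
  let L lam v := decision (G lam) (f lam) (I lam) (tb lam) (st lam) u = Some v
  in
  let gain lam v :=
    weight (f lam) (st lam) u - cur_weight_opt (f lam) (st lam) v in
  (exists lam v,
     [/\ L lam v,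
         forall mu w, L mu w -> gain mu w <= gain lam v,
         st' lam = update (st lam) u v
       & forall mu, mu != lam -> st' mu = st mu])
  \/ ((forall lam v, ~ L lam v) /\ forall mu, st' mu = st mu).

Inductive multi_run (R : realType) (T : choiceType) (Lam : finType)
    (G : Lam -> algorithm R) (f : Lam -> {fset T} -> R)
    (I : Lam -> pred {fset T}) (tb : Lam -> tie_rule T) :
    seq T -> (Lam -> state T) -> Prop :=
| multi_run_nil : multi_run G f I tb [::] (fun _ => init_state T)
| multi_run_rcons s u st st' :
    multi_run G f I tb s st -> multi_step G f I tb st u st' ->
    multi_run G f I tb (rcons s u) st'.

Definition is_assignment (T : choiceType) (Lam : finType)
    (I : Lam -> pred {fset T}) (s : seq T) (O : Lam -> {fset T}) : Prop :=
  [/\ forall lam, {subset O lam <= s},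
      forall lam, I lam (O lam)
    & forall lam mu, lam != mu -> O lam `&` O mu = fset0].

Definition is_opt_assignment (R : realType) (T : choiceType) (Lam : finType)
    (f : Lam -> {fset T} -> R) (I : Lam -> pred {fset T}) (s : seq T)
    (O : Lam -> {fset T}) : Prop :=
  is_assignment I s O /\
  forall X : Lam -> {fset T}, is_assignment I s X ->
    \sum_lam f lam (X lam) <= \sum_lam f lam (O lam).

(* Main.v *)
(* Fix an agent with final history A, and call an item missed if the agent does
   not get it. A missed item u is worth w(u) on arrival; if the subroutine would
   have accepted it and removed v, then lowering its worth to w_S(v) makes the
   subroutine reject it, and costs w(u) - w_S(v), which is at most the gain of
   the agent who did receive u. Replace f by
     g(X) = f((X n A) u (union of A(u) over the missed u in X))
            + (sum of the lowered worths of the missed u in X).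
   Letting every missed u bring along A(u) makes g monotone submodular, equal to
   f on subsets of A, and such that u has exactly its lowered worth on arrival.
   Hence the subroutine run on g alone reproduces the agent's states, and its
   competitive ratio bounds f(OPT) up to the gains of the missed items. Each
   round increases the objective of MULTI by at least its gain, so summing over
   the agents, whose sets OPT are disjoint, costs one more copy of the value of
   MULTI.

   That the lowered item is rejected needs an invariant of the subroutine. For
   MAT: all current weights are positive. For UNI_k: with q = 1 + (a-2)/(k+1),
   so that q^(k+1) = a, some ordering x_1, ..., x_n of S satisfies
   w(A) + sum_i q^i w_S(x_i) <= a w_S(S); as q >= 1 this puts the acceptance
   threshold above the least current weight. *)

Require Import Defs.
From HB Require Import structures.
From mathcomp Require Import all_boot all_order all_algebra finmap.
From mathcomp Require Import reals lra ring.

Set Implicit Arguments.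
Unset Strict Implicit.
Unset Printing Implicit Defensive.

Import Order.TTheory GRing.Theory Num.Theory.

Local Open Scope fset_scope.
Local Open Scope ring_scope.

(** * Marginals and constructions of monotone submodular functions *)

Section MonotoneSubmodular.
Variables (R : realType) (T : choiceType).
Implicit Types (f : {fset T} -> R) (X Y : {fset T}) (u : T).

Lemma marginal_ge0 f u X : monotone_submodular f -> 0 <= marginal f u X.
Proof. by case=> _ mf _; rewrite subr_ge0 mf // fsubsetU1. Qed.

Lemma marginal_anti f u X Y :
  monotone_submodular f -> X `<=` Y -> marginal f u Y <= marginal f u X.
Proof.
move=> hf XY; have [uY|uY] := boolP (u \in Y).
  by rewrite {1}/marginal mem_fset1U // subrr marginal_ge0.
case: hf => _ _ /(_ (u |` X) Y).
have -> : u |` X `|` Y = u |` Y by rewrite -fsetUA (fsetUidPr _ _ XY).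
have -> : (u |` X) `&` Y = X.
  apply/fsetP=> z; rewrite !inE; case: eqP => [->|_] /=.
    by rewrite (negPf uY); apply/esym/negP => /(fsubsetP XY); apply/negP.
  by apply/andP/idP => [[]//|zX]; rewrite zX (fsubsetP XY).
by rewrite /marginal; lra.
Qed.

Lemma le_sum_marginal f Y (l : seq T) : monotone_submodular f ->
  f (Y `|` [fset x in l]) <= f Y + \sum_(x <- l) marginal f x Y.
Proof.
move=> hf; elim: l => [|x l IH].
  rewrite big_nil addr0; case: hf => _ mf _; apply: mf.
  by apply/fsubsetP => z; rewrite !inE orbF.
rewrite big_cons.
have -> : Y `|` [fset z in x :: l] = x |` (Y `|` [fset z in l]).
  by apply/fsetP=> z; rewrite !inE orbCA.
have := marginal_anti x hf (fsubsetUl Y [fset z in l]).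
by move: IH; rewrite /marginal; lra.
Qed.

(** Read [r x y] as: [x] brings along [y]. Covering commutes with unions, and what an intersection
    covers lies in both covered sets, so monotonicity of [f] reduces the claim to submodularity of
    [f] at the covered sets. *)
Lemma monotone_submodular_cover f (A : {fset T}) (r : rel T) :
  monotone_submodular f ->
  monotone_submodular (fun X => f [fset y in A | has (r^~ y) X]).
Proof.
case=> f0 mf sf; split=> [X|X Y XY|X Y]; first exact: f0.
  apply: mf; apply/fsubsetP => y; rewrite !inE => /andP[-> /hasP[x xX rxy]].
  by apply/hasP; exists x => //; apply: (fsubsetP XY).
apply: le_trans (sf _ _); apply: lerD; apply: mf; apply/fsubsetP => y;
  rewrite !inE.
  case/andP=> -> /hasP[x]; rewrite inE => /orP[] xX rxy;
    apply/orP; [left|right]; by apply/hasP; exists x.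
case/andP=> -> /hasP[x]; rewrite inE => /andP[xX xY] rxy /=.
by apply/andP; split; apply/hasP; exists x.
Qed.

(** The added sum is modular, so it contributes equally to both sides of the submodular
    inequality. *)
Lemma monotone_submodular_addw f (s : seq T) (c : T -> R) :
  monotone_submodular f -> (forall x, x \in s -> 0 <= c x) ->
  monotone_submodular (fun X => f X + \sum_(x <- s | x \in X) c x).
Proof.
move=> [f0 mf sf] c0; split=> [X|X Y XY|X Y].
- by rewrite addr_ge0 // big_seq_cond sumr_ge0 // => x /andP[/c0].
- apply: lerD; first exact: mf.
  rewrite (big_mkcond (fun x => x \in X)) (big_mkcond (fun x => x \in Y)) /=.
  rewrite big_seq [leRHS]big_seq; apply: ler_sum => x /c0 cx.
  by case: ifP => [/(fsubsetP XY)->//|_]; case: ifP.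
- set S := fun Z : {fset T} => \sum_(x <- s | x \in Z) c x.
  suff E : S (X `|` Y) + S (X `&` Y) = S X + S Y.
    by move: (sf X Y) E; rewrite /S; lra.
  rewrite /S !(big_mkcond (fun x => x \in _)) /= -!big_split /=.
  apply: eq_bigr => x _; rewrite !inE.
  by do 2!case: (_ \in _); rewrite /= ?addr0 ?add0r.
Qed.

(** A competitive ratio compares with an optimum, so one must be exhibited before the ratio can be
    applied to a new objective. *)
Lemma is_opt_exists f (I : pred {fset T}) (s : seq T) :
  I fset0 -> exists O, is_opt f I s O.
Proof.
move=> I0; pose F := [fset X in fpowerset [fset x in s] | I X].
have F0 : fset0 \in F by rewrite !inE /= fpowersetE fsub0set.
pose O := [arg max_(i > FSetSub F0) f (val i)]%O.
have memF X : (X \in F) = [&& X `<=` [fset x in s] & I X].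
  by rewrite !inE /= fpowersetE.
exists (val O); have /andP[Os OI] : [&& val O `<=` [fset x in s] & I (val O)].
  by rewrite -memF; apply: valP.
split=> [x /(fsubsetP Os)||X Xs XI] //; first by rewrite !inE.
have XF : X \in F.
  by rewrite memF XI andbT; apply/fsubsetP => x /Xs; rewrite !inE.
rewrite /O; case: Order.TotalTheory.arg_maxP => // i _ hi.
exact: (hi (FSetSub XF)).
Qed.

End MonotoneSubmodular.

(** * Weights and decisions across one round *)

Section States.
Variables (R : realType) (T : choiceType).
Implicit Types (f g : {fset T} -> R) (st : state T) (u x : T) (v : option T).

Lemma hist_before_sub st x : hist_before st x `<=` [fset y in hist st].
Proof. by apply/fsubsetP => y; rewrite !inE => /mem_take. Qed.

Lemma hist_before_notin st u :
  u \notin hist st -> hist_before st u = [fset y in hist st].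
Proof. by move=> uh; rewrite /hist_before (memNindex uh) take_size. Qed.

Lemma hist_before_update_mem st u v x :
  x \in hist st -> hist_before (update st u v) x = hist_before st x.
Proof.
move=> xh; rewrite /hist_before /= -cats1 index_cat xh take_cat.
by rewrite index_mem xh.
Qed.

Lemma hist_before_update_new st u v :
  u \notin hist st -> hist_before (update st u v) u = [fset y in hist st].
Proof.
move=> uh; rewrite /hist_before /= -cats1 index_cat (negPf uh) /= eqxx addn0.
by rewrite take_size_cat.
Qed.

Lemma cur_update st u v x : x \in cur (update st u v) ->
  x = u \/ x \in cur st /\ v != Some x.
Proof.
rewrite /= !inE => /orP[/eqP|]; first by left.
by case: v => [y|] xS; right; [move: xS; rewrite !inE => /andP[xy ->]|];
  split => //; apply: contraNneq xy => -[->].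
Qed.

Lemma cur_update_sub st u v : {subset cur st <= hist st} ->
  {subset cur (update st u v) <= hist (update st u v)}.
Proof.
move=> sub x /cur_update [->|[/sub xh _]]; rewrite /= mem_rcons inE ?eqxx //.
by rewrite xh orbT.
Qed.

Section Update.
Variables (f : {fset T} -> R) (st : state T) (u : T) (v : option T).
Hypotheses (hf : monotone_submodular f) (uh : u \notin hist st).

Lemma weight_update x :
  x \in hist st -> weight f (update st u v) x = weight f st x.
Proof. by move=> xh; rewrite /weight hist_before_update_mem. Qed.

Lemma sum_weight_update :
  \sum_(x <- hist (update st u v)) weight f (update st u v) x =
  \sum_(x <- hist st) weight f st x + weight f st u.
Proof.
rewrite /= -cats1 big_cat big_seq1; congr (_ + _).
  by apply: eq_big_seq => x; apply: weight_update.
by rewrite /weight hist_before_update_new // hist_before_notin.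
Qed.

Lemma cur_weight_update x :
  x \in hist st -> cur_weight f st x <= cur_weight f (update st u v) x.
Proof.
move=> xh; rewrite /cur_weight hist_before_update_mem //.
apply: marginal_anti => //; apply/fsubsetP => y.
rewrite in_fsetI => /andP[yb yS]; rewrite in_fsetI yb /=.
case: (cur_update yS) => [yu|[]//].
by move/fsubsetP/(_ y yb): (hist_before_sub st x); rewrite inE yu (negPf uh).
Qed.

Lemma cur_weight_update_new :
  weight f st u <= cur_weight f (update st u v) u.
Proof.
rewrite /weight /cur_weight hist_before_update_new // hist_before_notin //.
by apply: marginal_anti => //; apply: fsubsetIl.
Qed.

(** [S - v] lies in A, so [u] adds at least w(u) to it; for [v] in S, A(v) meets S inside [S - v],
    so losing [v] costs at most its current weight. *)
Lemma update_gain : {subset cur st <= hist st} ->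
  f (cur st) + (weight f st u - cur_weight_opt f st v)
    <= f (cur (update st u v)).
Proof.
move=> sub; rewrite [cur (update _ _ _)]/=.
set S := if v is Some x then _ else _.
have SS : S `<=` cur st by rewrite /S; case: v => // x; apply: fsubD1set.
have add : weight f st u <= f (u |` S) - f S.
  rewrite /weight hist_before_notin //; apply: marginal_anti => //.
  by apply/fsubsetP => y /(fsubsetP SS)/sub; rewrite inE.
have rem : f (cur st) <= f S + cur_weight_opt f st v.
  rewrite /S; case: v => [x|]; last by rewrite addr0.
  have [xS|xS] := boolP (x \in cur st); last first.
    rewrite mem_fsetD1 //= lerDl; exact: marginal_ge0.
  rewrite -{1}(fsetD1K xS) -lerBlDl; apply: marginal_anti => //.
  apply/fsubsetP => y; rewrite !inE => /andP[yb ->]; rewrite andbT.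
  (* [take] stops just before position [index x], so [x] is not in its own context. *)
  by apply: contraTneq yb => ->; apply/negP => /index_ltn; rewrite ltnn.
by move: add rem; lra.
Qed.

End Update.

Lemma cur_weight_ge0 f st x : monotone_submodular f -> 0 <= cur_weight f st x.
Proof. exact: marginal_ge0. Qed.

Lemma weight_ge0 f st x : monotone_submodular f -> 0 <= weight f st x.
Proof. exact: marginal_ge0. Qed.

Lemma argmin_cur_weightP f st (C : {fset T}) x :
  reflect (x \in C /\
             forall y, y \in C -> cur_weight f st x <= cur_weight f st y)
          (x \in argmin_cur_weight f st C).
Proof.
rewrite /argmin_cur_weight !inE /=; apply: (iffP andP) => -[xC].
  by move=> /allP.
by move=> h; split=> //; apply/allP.
Qed.

Lemma argmin_cur_weight_neq0 f st (C : {fset T}) :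
  C != fset0 -> argmin_cur_weight f st C != fset0.
Proof.
case/fset0Pn => x0 x0C; apply/fset0Pn.
pose m := [arg min_(i < FSetSub x0C) cur_weight f st (val i)]%O.
exists (val m); apply/argmin_cur_weightP; split; first exact: valP.
rewrite /m; case: Order.TotalTheory.arg_minP => // i _ hi y yC.
exact: (hi (FSetSub yC)).
Qed.

(** All that a subroutine reads of its objective, apart from the weight of the arriving item. *)
Definition same_weights f g st :=
  (forall x, x \in cur st -> cur_weight g st x = cur_weight f st x) /\
  (forall x, x \in hist st -> weight g st x = weight f st x).

Lemma same_weights_sub f g st : {subset cur st <= hist st} ->
  (forall X, X `<=` [fset x in hist st] -> g X = f X) -> same_weights f g st.
Proof.
move=> sub fg.
have E x Y : x \in hist st -> Y `<=` hist_before st x ->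
    marginal g x Y = marginal f x Y.
  move=> xh /fsubset_trans/(_ (hist_before_sub _ _)) Yh.
  by rewrite /marginal !fg // fsubUset Yh andbT fsub1set inE.
by split=> x /[dup] xS; [move/sub|] => xh; apply: E => //; apply: fsubsetIl.
Qed.

Lemma argmin_cur_weight_same f g st (C : {fset T}) : same_weights f g st ->
  C `<=` cur st -> argmin_cur_weight g st C = argmin_cur_weight f st C.
Proof.
move=> [E _] /fsubsetP CS; apply/fsetP => x.
by apply/argmin_cur_weightP/argmin_cur_weightP => -[xC h]; split=> // y yC;
  move: (h y yC); rewrite !E //; apply: CS.
Qed.

(** A tie rule sees only the state, [u] and the set of minimizers, and equal weights give equal sets
    of minimizers. *)
Lemma decision_same (G : algorithm R) f g (I : pred {fset T}) tb st u :
  valid_tie_rule tb -> same_weights f g st -> weight g st u = weight f st u ->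
  decision G g I tb st u = decision G f I tb st u.
Proof.
move=> htb E Eu; case: G => [|k a] /=.
  rewrite /mat_decision Eu; case: ifP => // _; case: ifPn => // C0.
  have CS : [fset v in cur st | I (u |` (cur st `\ v))] `<=` cur st.
    exact: fset_sub.
  rewrite (argmin_cur_weight_same E CS) (proj1 E) //; apply: (fsubsetP CS).
  by have /argmin_cur_weightP[] := htb st u _ (argmin_cur_weight_neq0 f st C0).
rewrite /uni_decision Eu (argmin_cur_weight_same E (fsubset_refl _)).
by rewrite (eq_big_seq _ (proj1 E)) (eq_big_seq _ (proj2 E)).
Qed.

End States.

(** * The geometric potential for uniform matroids *)

Section UniInvariant.
Variable R : realType.

(** Horner form of the sum of [q ^+ i * h x_i], with [i] counted from 1. *)
Fixpoint horner_weight (T : Type) (q : R) (h : T -> R) (l : seq T) : R :=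
  if l is x :: l' then q * (h x + horner_weight q h l') else 0.

Variables (T : eqType) (q : R).
Hypothesis q1 : 1 <= q.
Implicit Types (h : T -> R) (l : seq T).

Let q0 : 0 <= q. Proof. exact: le_trans q1. Qed.

Lemma horner_weight_rcons h l x :
  horner_weight q h (rcons l x) = horner_weight q h l + q ^+ (size l).+1 * h x.
Proof.
elim: l => [|y l IH] /=; first by rewrite addr0 add0r expr1.
by rewrite IH [q ^+ (size l).+2]exprS; ring.
Qed.

(** Rearrangement by adjacent swaps: moving [x] past an item of larger weight puts the larger power
    of [q] on the smaller weight. *)
Lemma horner_weight_move_min h l1 x l2 :
  (forall y, y \in l2 -> h x <= h y) ->
  horner_weight q h (rcons (l1 ++ l2) x) <= horner_weight q h (l1 ++ x :: l2).
Proof.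
move=> hx; elim: l1 => [|y l1 IH] /=; last by rewrite ler_wpM2l // lerD2l.
elim: l2 hx => [|y l2 IH] hx //=; rewrite ler_wpM2l //.
have xy : h x <= h y by apply: hx; rewrite mem_head.
have {}IH := IH (fun z zl => hx z (mem_behead (s := y :: l2) zl)).
have : 0 <= (q - 1) * (h y - h x) by rewrite mulr_ge0 // subr_ge0.
by move: IH => /=; lra.
Qed.

Lemma sum_le_horner_weight h l : (forall x, 0 <= h x) ->
  \sum_(x <- l) h x <= horner_weight q h l.
Proof.
move=> h0; elim: l => [|x l IH] /=; first by rewrite big_nil.
rewrite big_cons.
have s0 : 0 <= \sum_(y <- l) h y by apply: sumr_ge0.
have e0 : 0 <= h x + horner_weight q h l by rewrite addr_ge0 // (le_trans s0).
have : 0 <= (q - 1) * (h x + horner_weight q h l) by rewrite mulr_ge0 // subr_ge0.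
by move: IH; lra.
Qed.

(** The exponents stop at [size l], so every increase is multiplied by at most [q ^+ n]. *)
Lemma horner_weight_raise n h h' l : (size l <= n)%N ->
  (forall x, x \in l -> h x <= h' x) ->
  horner_weight q h' l - horner_weight q h l
    <= q ^+ n * (\sum_(x <- l) h' x - \sum_(x <- l) h x).
Proof.
elim: l n => [|x l IH] [|n] //= ln hh; rewrite ?big_nil ?subrr ?mulr0 //.
have {}IH := IH n ln (fun z zl => hh z (mem_behead (s := x :: l) zl)).
have hx : 0 <= h' x - h x by rewrite subr_ge0 hh // mem_head.
rewrite !big_cons exprS.
have qn : 0 <= (q ^+ n - 1) * (h' x - h x).
  by rewrite mulr_ge0 // subr_ge0 exprn_ege1.
set s' := \sum_(y <- l) h' y in IH *; set s := \sum_(y <- l) h y in IH *.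
have -> : q * q ^+ n * (h' x + s' - (h x + s)) =
    q * (q ^+ n * (h' x - h x) + q ^+ n * (s' - s)) by ring.
rewrite -mulrBr ler_wpM2l //; move: IH qn; lra.
Qed.

(* The threshold acceptance rule of UNI, with W = w(A), the list l of the
   surviving items, m the removed weight, and w the weight of the new item. *)
Lemma horner_weight_step k (a W m w w' : R) h h' l :
  q ^+ k.+1 = a -> a - 2 = k.+1%:R * (q - 1) -> (size l < k)%N ->
  W + (horner_weight q h l + q ^+ k * m) <= a * (m + \sum_(x <- l) h x) ->
  k%:R^-1 * (a * (m + \sum_(x <- l) h x) - W) < w ->
  w <= w' -> (forall x, x \in l -> h x <= h' x) ->
  W + w + q * (w' + horner_weight q h' l) <= a * (w' + \sum_(x <- l) h' x).
Proof.
move=> qk aq lk inv hw ww' hh.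
have k0 : 0 < k%:R :> R by rewrite ltr0n (leq_ltn_trans _ lk).
have {}hw : a * (m + \sum_(x <- l) h x) - W <= k%:R * w.
  by rewrite -ler_pdivrMl ?ltW.
have raise : horner_weight q h' l - horner_weight q h l <=
    q ^+ k.-1 * (\sum_(x <- l) h' x - \sum_(x <- l) h x).
  by apply: horner_weight_raise => //; rewrite -ltnS (ltn_predK lk).
have qkE : q ^+ k = q * q ^+ k.-1 by rewrite -exprS (ltn_predK lk).
have sh : \sum_(x <- l) h x <= \sum_(x <- l) h' x.
  by rewrite big_seq [leRHS]big_seq; apply: ler_sum.
move: inv hw raise sh aq qk; rewrite -(natr1 k) exprS qkE.
set Q := horner_weight q h l; set Q' := horner_weight q h' l.
set S := \sum_(x <- l) h x; set S' := \sum_(x <- l) h' x.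
set p := q ^+ k.-1 => inv hw raise sh aq qk.
have p1 : 1 <= p by rewrite exprn_ege1.
(* Raising the weights: with the new item there are at most k of them, so the left side grows at
   rate at most [q * p], the k-th power of [q], which is at most [a]. *)
have grow : q * (w' + Q') - q * (w + Q) <= a * (w' - w + (S' - S)).
  have -> : q * (w' + Q') - q * (w + Q) = q * (w' - w + (Q' - Q)) by ring.
  apply: (@le_trans _ _ (q * (p * (w' - w + (S' - S))))).
    rewrite ler_wpM2l //.
    have : 0 <= (p - 1) * (w' - w) by rewrite mulr_ge0 // subr_ge0.
    by move: raise; lra.
  rewrite -qk -!mulrA ler_wpM2l // ler_peMl // mulr_ge0 //; last lra.
  exact: le_trans p1.
(* Before the raise: add [q - 1] times the acceptance inequality to [q] times the invariant. The top
   power of [q] being [a] cancels the removed weight [m], and the equation for [a - 2] turns k(q -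
   1) into a - 1 - q. *)
have old : W + w + q * (w + Q) <= a * (w + S).
  have hw' : 0 <= (q - 1) * (k%:R * w - (a * (m + S) - W)).
    by rewrite mulr_ge0 // subr_ge0.
  have inv' : q * (W + (Q + q * p * m)) <= q * (a * (m + S)) by rewrite ler_wpM2l.
  have am : q * (q * p * m) = a * m by rewrite -qk; ring.
  have kw : (k%:R * (q - 1)) * w = (a - 1 - q) * w by congr (_ * _); lra.
  move: hw' inv' am kw; lra.
by move: grow old; lra.
Qed.

End UniInvariant.

(** * Invariants of the two subroutines *)

Section Invariant.
Variables (R : realType) (T : choiceType).
Implicit Types (f g : {fset T} -> R) (st : state T) (u x : T) (v : option T).

Definition uni_ratio (k : nat) (a : R) : R := 1 + (a - 2) / k.+1%:R.

(* In the ordering [l] the removed item moves to the end of the list and the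
   new one enters at the front; [uni_ratio k a ^+ k.+1 = a] is exactly what
   makes the inequality stable under the acceptance threshold. *)
Definition uni_invariant k a f st := exists l, [/\ perm_eq l (cur st),
  (size l <= k)%N &
  \sum_(x <- hist st) weight f st x
    + horner_weight (uni_ratio k a) (cur_weight f st) l
  <= a * \sum_(x <- l) cur_weight f st x].

Definition invariant (G : algorithm R) f st : Prop :=
  match G with
  | MAT => forall x, x \in cur st -> 0 < cur_weight f st x
  | UNI k a => uni_invariant k a f st
  end.

Lemma uni_ratioE k a : is_alpha k a ->
  [/\ 1 <= uni_ratio k a, uni_ratio k a ^+ k.+1 = a
    & a - 2 = k.+1%:R * (uni_ratio k a - 1)].
Proof.
case=> /andP[a3 _] aE; have k0 : 0 < k.+1%:R :> R by rewrite ltr0n.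
split; [|by rewrite [RHS]aE|].
  by rewrite /uni_ratio lerDl divr_ge0 ?ltW //; lra.
by rewrite /uni_ratio [1 + _]addrC addrK mulrC divfK // gt_eqF.
Qed.

Lemma invariant_init (G : algorithm R) f : invariant G f (init_state T).
Proof.
case: G => [|k a] /=; first by move=> x; rewrite inE.
by exists [::]; split=> //=; rewrite !big_nil mulr0 addr0.
Qed.

(** In the invariant each current weight carries a power of [q >= 1]; replacing these powers by 1
    only weakens it. *)
Lemma uni_threshold_ge f k a st : monotone_submodular f -> is_alpha k a ->
  uni_invariant k a f st ->
  \sum_(x <- cur st) cur_weight f st x
   <= a * (\sum_(x <- cur st) cur_weight f st x)
      - \sum_(x <- hist st) weight f st x.
Proof.
move=> hf /uni_ratioE[q1 _ _] [l [lS _ inv]].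
have := sum_le_horner_weight q1 l (fun x => cur_weight_ge0 st x hf).
by move: inv; rewrite (perm_big _ lS) /=; lra.
Qed.

(** The threshold is at least w_S(S)/k, which bounds the least current weight as soon as S has k
    items. *)
Lemma uni_removed_le f k a tb st u v : monotone_submodular f ->
  valid_tie_rule tb -> (4 <= k)%N -> is_alpha k a -> uni_invariant k a f st ->
  uni_decision f k a tb st u = Some v ->
  cur_weight_opt f st v <=
    k%:R^-1 * (a * (\sum_(x <- cur st) cur_weight f st x)
                - \sum_(x <- hist st) weight f st x).
Proof.
move=> hf htb k4 ha inv; have thr := uni_threshold_ge hf ha inv.
have k0 : 0 < k%:R :> R by rewrite ltr0n (leq_trans _ k4).
rewrite /uni_decision; case: ifP => // _ [<-]; rewrite ler_pdivlMl //.
apply: le_trans thr; case: ifPn => [_|]; rewrite /cur_weight_opt.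
  by rewrite mulr0 sumr_ge0 // => x _; apply: cur_weight_ge0.
rewrite -leqNgt => kS.
have S0 : cur st != fset0.
  by rewrite -cardfs_gt0 (leq_trans _ kS) // (leq_trans _ k4).
have /argmin_cur_weightP[] := htb st u _ (argmin_cur_weight_neq0 f st S0).
set x := tb _ _ _ => xS xmin.
apply: (@le_trans _ _ (\sum_(y <- cur st) cur_weight f st x)).
  rewrite big_const_seq count_predT iter_addr_0 -[leRHS]mulr_natl.
  by rewrite ler_wpM2r ?cur_weight_ge0 // ler_nat.
by rewrite big_seq [leRHS]big_seq; apply: ler_sum.
Qed.

Lemma uni_decision_lt f k a tb st u v : uni_decision f k a tb st u = Some v ->
  k%:R^-1 * (a * (\sum_(x <- cur st) cur_weight f st x)
              - \sum_(x <- hist st) weight f st x) < weight f st u.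
Proof. by rewrite /uni_decision; case: ifP. Qed.

Lemma uni_invariant_update f k a tb st u v : monotone_submodular f ->
  valid_tie_rule tb -> (4 <= k)%N -> is_alpha k a -> uni_invariant k a f st ->
  {subset cur st <= hist st} -> u \notin hist st ->
  uni_decision f k a tb st u = Some v ->
  uni_invariant k a f (update st u v).
Proof.
move=> hf htb k4 ha [l [lS lk inv]] sub uh dec.
have [q1 qk aq] := uni_ratioE ha.
have thr := uni_decision_lt dec.
have uS : u \notin cur st by apply: contra uh => /sub.
set q := uni_ratio k a in inv q1 qk aq *.
(* [l'] is the ordering without the removed item. A free insertion counts as removing weight 0, so
   one computation serves both cases. *)
have [l' [l'S l'k inv' sumE]] : exists l',
   [/\ perm_eq (u :: l') (cur (update st u v)), (size l' < k)%N,
    \sum_(x <- hist st) weight f st x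
    + (horner_weight q (cur_weight f st) l' + q ^+ k * cur_weight_opt f st v)
    <= a * (cur_weight_opt f st v + \sum_(x <- l') cur_weight f st x) &
    \sum_(x <- cur st) cur_weight f st x =
      cur_weight_opt f st v + \sum_(x <- l') cur_weight f st x].
  move: dec; rewrite /uni_decision thr => -[<-].
  case: ifPn => [lt|]; rewrite /cur_weight_opt.
    exists l; rewrite mulr0 addr0 add0r (perm_size lS) lt -(perm_big _ lS).
    split=> //; apply: uniq_perm => /=; rewrite ?fset_uniq //.
      by rewrite (perm_mem lS) uS (perm_uniq lS) fset_uniq.
    by move=> y; rewrite !inE (perm_mem lS).
  rewrite -leqNgt => kS.
  have S0 : cur st != fset0.
  by rewrite -cardfs_gt0 (leq_trans _ kS) // (leq_trans _ k4).
  have /argmin_cur_weightP[] := htb st u _ (argmin_cur_weight_neq0 f st S0).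
  set x := tb _ _ _ => xS xmin.
  (* As S is full, the removed item, once moved to the end, carries exactly the exponent k. *)
  have lkE : size l = k by apply/eqP; rewrite eqn_leq lk (perm_size lS).
  have : x \in l by rewrite (perm_mem lS).
  case/splitPr E : _ / => [l1 l2]; rewrite {}E in lS lk inv lkE.
  have /andP[xl lU] : (x \notin l1 ++ l2) && uniq (l1 ++ l2).
    have := fset_uniq (cur st); rewrite -(perm_uniq lS) /= !cat_uniq /=.
    by rewrite mem_cat !negb_or => /and3P[-> /andP[-> ->] /andP[-> ->]].
  exists (l1 ++ l2).
  have sE : (size (l1 ++ l2)).+1 = k by rewrite -lkE !size_cat /= addnS.
  have bE (h : T -> R) :
      \sum_(y <- l1 ++ x :: l2) h y = h x + \sum_(y <- l1 ++ l2) h y.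
    by rewrite !big_cat big_cons /= addrCA.
  split.
  - apply: uniq_perm; rewrite ?fset_uniq //.
      rewrite /= lU andbT.
      apply: contra uS; rewrite -(perm_mem lS) !mem_cat inE.
      by case/orP=> ->; rewrite ?orbT.
    move=> y; rewrite !inE -(perm_mem lS) !mem_cat !inE.
    case: (y =P u) => //= _; case: (y =P x) => [->|_] //=.
    by move: xl; rewrite mem_cat => /negPf.
  - by rewrite -sE.
  - rewrite -bE; apply: le_trans inv; rewrite lerD2l -{1}sE -horner_weight_rcons.
    apply: horner_weight_move_min => // y yl2; apply: xmin.
    by rewrite -(perm_mem lS) mem_cat inE yl2 !orbT.
  - by rewrite -(perm_big _ lS) bE.
exists (u :: l'); split=> //; rewrite sum_weight_update // big_cons.
rewrite sumE in thr.
apply: (horner_weight_step q1 qk aq l'k inv' thr).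
  exact: cur_weight_update_new.
move=> x xl'; apply: cur_weight_update => //.
have : x \in cur (update st u v) by rewrite -(perm_mem l'S) inE xl' orbT.
case/cur_update=> [xu|[/sub]//].
by have := fset_uniq (cur (update st u v)); rewrite -(perm_uniq l'S) /= -xu xl'.
Qed.

Lemma mat_decision_some f (I : pred {fset T}) tb st u v :
  valid_tie_rule tb -> mat_decision f I tb st u = Some v ->
  if v is Some x then
    [/\ ~~ (I (u |` cur st) && (0 < weight f st u)), x \in cur st &
        2 * cur_weight f st x <= weight f st u]
  else 0 < weight f st u.
Proof.
move=> htb; rewrite /mat_decision; case: ifPn => [/andP[_ w0] [<-] //|nI].
case: ifPn => // C0; case: ifP => // le [<-]; split=> //.
have /argmin_cur_weightP[] := htb st u _ (argmin_cur_weight_neq0 f st C0).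
by rewrite !inE => /andP[].
Qed.

Section Decision.
Variables (G : algorithm R) (f : {fset T} -> R) (I : pred {fset T}).
Variables (tb : tie_rule T) (st : state T) (u : T) (v : option T).
Hypotheses (hf : monotone_submodular f) (hG : valid_algorithm G I).
Hypotheses (htb : valid_tie_rule tb) (inv : invariant G f st).
Hypothesis dec : decision G f I tb st u = Some v.

(** This lets gains serve as the nonnegative costs [rho]. *)
Lemma gain_ge0 : 0 <= weight f st u - cur_weight_opt f st v.
Proof.
rewrite subr_ge0; case: G hG inv dec => [|k a] /=;
  [move=> _ h d|move=> [k4 ak _] h d].
  have := mat_decision_some htb d; case: v => [x|] /=; last exact: ltW.
  by case=> _ _; have := cur_weight_ge0 st x hf; lra.
apply: ltW; apply: le_lt_trans (uni_decision_lt d).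
exact: (uni_removed_le hf htb k4 ak h d).
Qed.

(** For MAT, surviving weights can only rise, and the new one is positive: by the insertion test, or
    as at least twice a positive weight. *)
Lemma invariant_update : {subset cur st <= hist st} -> u \notin hist st ->
  invariant G f (update st u v).
Proof.
move=> sub uh; case: G hG inv dec => [|k a] /=;
  [move=> _ h d|move=> [k4 ak _] h d].
  move=> x /cur_update[->|[xS _]]; last first.
    by apply: lt_le_trans (h x xS) _; apply: cur_weight_update => //; apply: sub.
  apply: lt_le_trans (cur_weight_update_new _ hf uh).
  have := mat_decision_some htb d; case: v => [y|] //= [_ yS].
  by have := h y yS; lra.
exact: (uni_invariant_update hf htb k4 ak h sub uh d).
Qed.

(* An item whose weight only equals that of the item it would replace is
   rejected. *)
Lemma decision_discount g : same_weights f g st ->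
  weight g st u = cur_weight_opt f st v -> decision G g I tb st u = None.
Proof.
move=> E wE; case: G hG inv dec => [|k a] /=;
  [move=> _ h d|move=> [k4 ak _] h d]; last first.
  have := uni_removed_le hf htb k4 ak h d; rewrite -wE leNgt => /negPf thr.
  by rewrite /uni_decision (eq_big_seq _ (proj1 E)) (eq_big_seq _ (proj2 E)) thr.
have ms := mat_decision_some htb d.
rewrite /mat_decision wE; case: ifPn => [/andP[uI]|_].
  case: v ms => [x|] /=; last by rewrite ltxx.
  (* Under [f] the weight of [u] is at least twice a positive one, so [u] would have been inserted
     freely rather than exchanged for [x]. *)
  case=> nI xS le x0; case/negP: nI; rewrite uI; lra.
case: ifPn => // C0.
have CS : [fset v in cur st | I (u |` (cur st `\ v))] `<=` cur st.
  exact: fset_sub.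
rewrite (argmin_cur_weight_same E CS).
set y := tb _ _ _; have yS : y \in cur st.
  apply: (fsubsetP CS).
  by have /argmin_cur_weightP[] := htb st u (argmin_cur_weight_neq0 f st C0).
rewrite (proj1 E) //; case: ifP => // le; have y0 := h y yS.
(* With [v = None] the lowered weight is 0, below twice the positive weight of [y]. Otherwise the
   tie rule returns the same item, [y = x], and twice a positive weight exceeds it. *)
case: v d ms wE le => [x|] /= d ms wE le; exfalso; last by lra.
move: d; rewrite /mat_decision; case: ms => nI _ _.
rewrite (negPf nI) (negPf C0) -/y; case: ifP => // _ [yx]; move: le; rewrite -yx; lra.
Qed.

End Decision.
End Invariant.

(** * One agent's view of a run, replayed under a modified objective *)

Section AgentTrace.
Variables (R : realType) (T : choiceType).
Variables (G : algorithm R) (f : {fset T} -> R) (I : pred {fset T}).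
Variable tb : tie_rule T.
Hypotheses (hf : monotone_submodular f) (hG : valid_algorithm G I).
Hypothesis htb : valid_tie_rule tb.
Implicit Types (s : seq T) (st : state T) (u x : T) (v : option T).
Implicit Types (B : T -> {fset T}) (om rho : T -> R).

(* The rounds of MULTI seen by one agent. An item that the agent does not get
   would also be rejected if its weight were lowered to [om u], and lowering it
   costs at most [rho u]; [B u] is the set A(u). *)
Inductive agent_trace B om rho : seq T -> state T -> Prop :=
| agent_trace_nil : agent_trace B om rho [::] (init_state T)
| agent_trace_accept s st u v :
    agent_trace B om rho s st -> u \notin s ->
    decision G f I tb st u = Some v ->
    agent_trace B om rho (rcons s u) (update st u v)
| agent_trace_reject s st u :
    agent_trace B om rho s st -> u \notin s ->
    B u = hist_before st u -> 0 <= om u -> weight f st u <= om u + rho u ->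
    (forall g, same_weights f g st -> weight g st u = om u ->
       decision G g I tb st u = None) ->
    agent_trace B om rho (rcons s u) st.

Lemma agent_trace_eq B B' om om' rho rho' s st : agent_trace B om rho s st ->
  (forall x, x \in s -> [/\ B x = B' x, om x = om' x & rho x = rho' x]) ->
  agent_trace B' om' rho' s st.
Proof.
elim=> [|{}s {}st u v _ IH us dec|{}s {}st u _ IH us BE o0 le rej] eqs.
- exact: agent_trace_nil.
- apply: agent_trace_accept => //; apply: IH => x xs.
  by apply: eqs; rewrite mem_rcons inE xs orbT.
- have [] : [/\ B u = B' u, om u = om' u & rho u = rho' u].
    by apply: eqs; rewrite mem_rcons mem_head.
  move=> B1 o1 r1; apply: agent_trace_reject; rewrite -?B1 -?o1 -?r1 //.
  by apply: IH => x xs; apply: eqs; rewrite mem_rcons inE xs orbT.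
Qed.

Lemma agent_trace_wf B om rho s st : agent_trace B om rho s st ->
  [/\ {subset hist st <= s}, {subset cur st <= hist st} & invariant G f st].
Proof.
elim=> [|{}s {}st u v _ [hs ch inv] us dec|{}s {}st u _ [hs ch inv] us _ _ _ _].
- by split=> [x|x|]; rewrite ?inE //; apply: invariant_init.
- have uh : u \notin hist st by apply: contra us => /hs.
  split; [|exact: cur_update_sub|exact: (invariant_update hf hG htb inv dec)].
  by move=> x; rewrite /= !mem_rcons !inE => /orP[->//|/hs->]; rewrite orbT.
- by split=> // x /hs xs; rewrite mem_rcons inE xs orbT.
Qed.

Lemma agent_trace_missed B om rho s st u : agent_trace B om rho s st ->
  u \in s -> u \notin hist st ->
  [/\ B u `<=` [fset x in hist st], 0 <= om u &
      marginal f u (B u) <= om u + rho u].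
Proof.
elim=> [//|{}s {}st x v tr IH xs dec|{}s {}st x tr IH xs BE o0 le rej].
  rewrite /= !mem_rcons !inE negb_or => us /andP[ux uh].
  have [Bh o0 le] : [/\ B u `<=` [fset y in hist st], 0 <= om u
    & marginal f u (B u) <= om u + rho u].
    by apply: IH => //; move: us; rewrite (negPf ux).
  split=> //; apply: (fsubset_trans Bh); apply/fsubsetP => y.
  rewrite !inE => yh; by rewrite mem_rcons inE yh orbT.
rewrite mem_rcons inE => /orP[/eqP->|us] uh; last exact: IH.
by rewrite BE; split=> //; apply: hist_before_sub.
Qed.

(** Accepted items and their contexts lie in the final A, where [g] agrees with [f]; a missed item
    arrives with weight exactly [om u], which triggers its rejection clause. *)
Lemma agent_trace_simulate B om rho s st g : agent_trace B om rho s st ->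
  (forall X, X `<=` [fset x in hist st] -> g X = f X) ->
  (forall u, u \in s -> u \notin hist st -> marginal g u (B u) = om u) ->
  single_run G g I tb s = st.
Proof.
elim=> [//|{}s {}st u v tr IH us dec|{}s {}st u tr IH us BE o0 le rej] gf gom;
    have [hs ch inv] := agent_trace_wf tr;
    have uh : u \notin hist st by apply: contra us => /hs.
  have hh : [fset x in hist st] `<=` [fset x in hist (update st u v)].
    by apply/fsubsetP => y; rewrite !inE /= mem_rcons inE => ->; rewrite orbT.
  have gf' X : X `<=` [fset x in hist st] -> g X = f X.
    by move=> /fsubset_trans/(_ hh)/gf.
  rewrite /single_run -cats1 foldl_cat -/(single_run G g I tb s) /=.
  rewrite IH //; last first.
    move=> x xs xh; apply: gom; first by rewrite mem_rcons inE xs orbT.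
    by rewrite /= mem_rcons inE negb_or xh andbT; apply: contraNneq us => <-.
  rewrite (decision_same G I htb (same_weights_sub ch gf')) ?dec //.
  have uH : u \in hist (update st u v) by rewrite /= mem_rcons mem_head.
  rewrite /weight hist_before_notin // /marginal (gf' _ (fsubset_refl _)) gf //.
  by rewrite fsubUset hh andbT fsub1set inE.
rewrite /single_run -cats1 foldl_cat -/(single_run G g I tb s) /=.
rewrite IH //; last first.
  by move=> x xs; apply: gom; rewrite mem_rcons inE xs orbT.
rewrite rej //; first exact: same_weights_sub.
by rewrite /weight -BE gom // mem_rcons mem_head.
Qed.

Lemma agent_trace_ratio B om rho s st alpha (O : {fset T}) : 0 < alpha ->
  has_competitive_ratio G I tb (1 / alpha) -> I fset0 -> uniq s ->
  (forall x, 0 <= rho x) -> agent_trace B om rho s st ->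
  I O -> {subset O <= s} ->
  f O <= alpha * f (cur st) + \sum_(x <- O) rho x.
Proof.
move=> a0 ratio I0 us rho0 tr IO Os.
have [hs ch _] := agent_trace_wf tr; have miss := agent_trace_missed tr.
pose A := [fset x in hist st].
(* Every item brings itself, and a missed one also brings A(x); [cover] then keeps only what lies in
   A. *)
pose r : rel T := fun x y => (y == x) || (x \notin A) && (y \in B x).
pose c x := if x \in A then 0 else om x.
pose cover (X : {fset T}) := [fset y in A | has (r^~ y) X].
pose g X := f (cover X) + \sum_(x <- s | x \in X) c x.
have memA x : (x \in A) = (x \in hist st) by rewrite inE.
have c0 x : x \in s -> 0 <= c x.
  by rewrite /c memA; case: ifPn => // xh xs; case: (miss x xs xh).
have hg : monotone_submodular g.
  apply: monotone_submodular_addw => //; exact: monotone_submodular_cover.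
have coverA X : X `<=` A -> cover X = X.
  move/fsubsetP=> XA; apply/fsetP => y; rewrite !inE.
  apply/andP/idP => [[yA /hasP[x xX]]|yX].
    by rewrite /r XA //= orbF => /eqP->.
  split; first by have := XA y yX; rewrite inE.
  by apply/hasP; exists y => //; rewrite /r eqxx.
have gA X : X `<=` A -> g X = f X.
  move=> XA; rewrite /g coverA // big1 ?addr0 // => x xX.
  by rewrite /c (fsubsetP XA).
have gom u : u \in s -> u \notin hist st -> marginal g u (B u) = om u.
  move=> ums uh; have [BA _ _] := miss u ums uh; rewrite /marginal (gA _ BA).
  have uB : u \notin B u by apply: contra uh => /(fsubsetP BA); rewrite inE.
  (* The missed [u] is itself dropped from the cover and brings nothing beyond [B u], so its
     marginal comes from the modular part alone. *)
  rewrite /g; have -> : cover (u |` B u) = B u.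
    apply/fsetP => y; rewrite !inE; apply/andP/idP => [[yA /hasP[x]]|yB].
      rewrite !inE => /orP[/eqP->|xB]; rewrite /r.
        by case/orP=> [/eqP yu|/andP[]//]; rewrite -yu yA in uh.
      by rewrite (fsubsetP BA) //= orbF => /eqP->.
    split; first by have := fsubsetP BA y yB; rewrite inE.
    apply/hasP; exists u; first by rewrite !inE eqxx.
    by rewrite /r memA uh yB orbT.
  rewrite [X in _ + X - _](_ : _ = c u); last first.
    rewrite big_mkcond (bigD1_seq u) //= fset1U1 big1 ?addr0 // => x xu.
    by rewrite !inE (negPf xu) /=; case: ifP => // xB; rewrite /c (fsubsetP BA).
  by rewrite /c memA (negPf uh) addrC addKr.
have run : single_run G g I tb s = st by apply: agent_trace_simulate tr _ _.
have gO : g O <= alpha * f (cur st).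
  have [O' hO'] := is_opt_exists g s I0.
  have [_ _ /(_ O Os IO) le] := hO'.
  have := ratio g hg s us O' hO'; rewrite run (gA (cur st)); last first.
    by apply/fsubsetP => x /ch; rewrite inE.
  by rewrite mul1r ler_pdivrMl //; apply: le_trans.
apply: (@le_trans _ _ (g O + \sum_(x <- O) rho x)); last by rewrite lerD2r.
have -> : g O = f (cover O) + \sum_(x <- O) c x.
  rewrite /g -big_filter; congr (_ + _); apply: perm_big.
  apply: uniq_perm; rewrite ?filter_uniq ?fset_uniq // => x.
  by rewrite mem_filter; apply/andP/idP => [[]//|xO]; rewrite Os.
rewrite -addrA -big_split /=.
(* Items of A already lie in [cover O] and have marginal 0; a missed [x] has [B x] inside [cover O],
   so its marginal is at most [om x + rho x]. *)
have le_cover : f O <= f (cover O) + \sum_(x <- O) marginal f x (cover O).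
  apply: le_trans (le_sum_marginal (cover O) O hf).
  case: hf => _ mf _; apply: mf; apply/fsubsetP => x xO.
  by apply/fsetUP; right; rewrite inE.
apply: (le_trans le_cover); rewrite lerD2l.
rewrite big_seq [leRHS]big_seq; apply: ler_sum => x xO.
have [xA|xA] := boolP (x \in A).
  rewrite /c xA add0r /marginal mem_fset1U ?subrr //.
  rewrite !inE -memA xA /=; apply/hasP; exists x => //; exact/orP/or_introl.
rewrite /c (negPf xA); rewrite memA in xA; have [BA _ le] := miss x (Os x xO) xA.
apply: le_trans le; apply: marginal_anti => //; apply/fsubsetP => y yB.
have := fsubsetP BA y yB; rewrite !inE => -> /=.
by apply/hasP; exists x => //; rewrite /r memA xA yB orbT.
Qed.

End AgentTrace.

(** * Combining the agents *)

Lemma sum_disjoint_le (R : realType) (T : choiceType) (Lam : finType)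
    (s : seq T) (O : Lam -> {fset T}) (rho : T -> R) :
  uniq s -> (forall x, 0 <= rho x) -> (forall lam, {subset O lam <= s}) ->
  (forall lam mu, lam != mu -> O lam `&` O mu = fset0) ->
  \sum_lam \sum_(x <- O lam) rho x <= \sum_(x <- s) rho x.
Proof.
move=> us rho0 Os Odis.
have E lam : \sum_(x <- O lam) rho x =
    \sum_(x <- s) (if x \in O lam then rho x else 0).
  rewrite -big_mkcond -[RHS]big_filter; apply: perm_big.
  apply: uniq_perm; rewrite ?filter_uniq ?fset_uniq // => x.
  by rewrite mem_filter; apply/idP/andP => [xO|[]//]; rewrite (Os lam).
rewrite (eq_bigr _ (fun lam _ => E lam)) exchange_big /=; apply: ler_sum => x _.
have [lam xO|none] := pickP (fun lam => x \in O lam); last first.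
  by rewrite big1 // => mu _; rewrite none.
rewrite (bigD1 lam) //= xO big1 ?addr0 // => mu ml; case: ifP => // xO'.
by have := in_fset0 x; rewrite -(Odis mu lam ml) in_fsetI xO xO'.
Qed.

(** Take for [rho u] the gain of the agent who receives [u], or 0 if [u] is discarded. One [rho]
    serves all agents because MULTI picks the largest gain. *)
Lemma multi_run_traces (R : realType) (T : choiceType) (Lam : finType)
    (f : Lam -> {fset T} -> R) (I : Lam -> pred {fset T})
    (G : Lam -> algorithm R) (tb : Lam -> tie_rule T) (s : seq T)
    (st : Lam -> state T) :
  (forall lam, monotone_submodular (f lam)) ->
  (forall lam, valid_algorithm (G lam) (I lam)) ->
  (forall lam, valid_tie_rule (tb lam)) ->
  multi_run G f I tb s st -> uniq s ->
  exists B om rho,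
    [/\ forall lam,
          agent_trace (G lam) (f lam) (I lam) (tb lam) (B lam) (om lam) rho
            s (st lam),
        forall x, 0 <= rho x
      & \sum_(x <- s) rho x <= \sum_lam f lam (cur (st lam))].
Proof.
move=> hf hG htb; elim=> [_|{}s u {}st st' _ IH step].
  exists (fun _ _ => fset0), (fun _ _ => 0), (fun _ => 0); split=> //.
    by move=> lam; apply: agent_trace_nil.
  by rewrite big_nil sumr_ge0 // => lam _; case: (hf lam).
rewrite rcons_uniq => /andP[us /IH[B [om [rho [tr rho0 sum_rho]]]]].
pose dec mu := decision (G mu) (f mu) (I mu) (tb mu) (st mu) u.
pose B' mu x := if x == u then hist_before (st mu) u else B mu x.
(* If the agent proposes to take [u], lower it to the weight it would remove; if it rejects [u]
   anyway, keep the weight at no cost. *)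
pose om' mu x :=
  if x != u then om mu x
  else if dec mu is Some v then cur_weight_opt (f mu) (st mu) v
  else weight (f mu) (st mu) u.
have rej mu rho' : (forall x, x \in s -> rho x = rho' x) ->
    0 <= rho' u ->
    (forall v, dec mu = Some v ->
      weight (f mu) (st mu) u - cur_weight_opt (f mu) (st mu) v <= rho' u) ->
    agent_trace (G mu) (f mu) (I mu) (tb mu) (B' mu) (om' mu) rho'
      (rcons s u) (st mu).
  move=> rhoE rho'u gain.
  have [hs ch inv] := agent_trace_wf (hf mu) (hG mu) (htb mu) (tr mu).
  apply: agent_trace_reject => //.
  - apply: agent_trace_eq (tr mu) _ => x xs; rewrite /B' /om'.
    have xu : (x == u) = false by apply: contraNF us => /eqP <-.
    by rewrite xu rhoE.
  - by rewrite /B' eqxx.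
  - rewrite /om' eqxx /=; case: (dec mu) => [[v|]|] //=.
      exact: cur_weight_ge0.
    exact: weight_ge0.
  - rewrite /om' eqxx /=; case E: (dec mu) => [v|]; last by rewrite lerDl.
    by rewrite -lerBlDl gain.
  - move=> g E; rewrite /om' eqxx /=; case D: (dec mu) => [v|] wE.
      exact: (decision_discount (hf mu) (hG mu) (htb mu) inv D).
    by rewrite (decision_same _ _ (htb mu) E).
case: step => [[lam [v [lamv best st'lam st'mu]]]|[none st'E]].
- have [hs ch inv] := agent_trace_wf (hf lam) (hG lam) (htb lam) (tr lam).
  have uh : u \notin hist (st lam) by apply: contra us => /hs.
  set gain := weight (f lam) (st lam) u
    - cur_weight_opt (f lam) (st lam) v in best.
  have gain0 : 0 <= gain by apply: (gain_ge0 (hf lam) (hG lam) (htb lam) inv lamv).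
  pose rho' x := if x == u then gain else rho x.
  have rhoE x : x \in s -> rho x = rho' x.
    by rewrite /rho'; case: eqP => // -> xs; rewrite xs in us.
  have rho'u : rho' u = gain by rewrite /rho' eqxx.
  exists B', om', rho'; split=> [mu|x|].
  + have [->|ml] := eqVneq mu lam; last first.
      by rewrite st'mu //; apply: rej => //; rewrite rho'u // => w /best.
    rewrite st'lam; apply: agent_trace_accept => //.
    apply: agent_trace_eq (tr lam) _ => x xs; rewrite /B' /om' rhoE //.
    have xu : (x == u) = false by apply: contraNF us => /eqP <-.
    by rewrite xu.
  + by rewrite /rho'; case: ifP.
  + rewrite -cats1 big_cat big_seq1 /= rho'u -(eq_big_seq _ rhoE).
    (* Only the value of [lam] changes, and it rises by at least [gain]. *)
    rewrite (bigD1 lam) //= in sum_rho.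
    rewrite (bigD1 lam) //= st'lam.
    rewrite (eq_bigr (fun mu => f mu (cur (st mu)))); last first.
      by move=> mu ml; rewrite st'mu.
    have := update_gain v (hf lam) uh ch; rewrite -/gain; move: sum_rho => /=.
    by lra.
- pose rho' x := if x == u then 0 else rho x.
  have rhoE x : x \in s -> rho x = rho' x.
    by rewrite /rho'; case: eqP => // -> xs; rewrite xs in us.
  have rho'u : rho' u = 0 by rewrite /rho' eqxx.
  exists B', om', rho'; split=> [mu|x|].
  + by rewrite st'E; apply: rej => //; rewrite rho'u // => v /none.
  + by rewrite /rho'; case: ifP.
  + rewrite -cats1 big_cat big_seq1 /= rho'u addr0 -(eq_big_seq _ rhoE).
    rewrite (eq_bigr (fun mu => f mu (cur (st mu)))) // => mu _.
    by rewrite st'E.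
Qed.

Theorem theorem8p1 (R : realType) (T : choiceType) (Lam : finType)
    (f : Lam -> {fset T} -> R) (I : Lam -> pred {fset T})
    (G : Lam -> algorithm R) (tb : Lam -> tie_rule T) (alpha : R)
    (hf : forall lam, monotone_submodular (f lam))
    (hI : forall lam, matroid (I lam))
    (hI1 : forall lam x, I lam [fset x])
    (hG : forall lam, valid_algorithm (G lam) (I lam))
    (htb : forall lam, valid_tie_rule (tb lam))
    (halpha : 0 < alpha)
    (hratio : forall lam,
       has_competitive_ratio (G lam) (I lam) (tb lam) (1 / alpha))
    (s : seq T) (hs : uniq s)
    (st : Lam -> state T) (hrun : multi_run G f I tb s st)
    (OPT : Lam -> {fset T}) (hOPT : is_opt_assignment f I s OPT) :
  1 / (alpha + 1) * (\sum_lam f lam (OPT lam))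
    <= \sum_lam f lam (cur (st lam)).
Proof.
have [B [om [rho [tr rho0 sum_rho]]]] := multi_run_traces hf hG htb hrun hs.
have [[Os OI Odis] _] := hOPT.
have le lam : f lam (OPT lam) <=
    alpha * f lam (cur (st lam)) + \sum_(x <- OPT lam) rho x.
  have [I0 _ _] := hI lam.
  exact: (agent_trace_ratio (hf lam) (hG lam) (htb lam) halpha (hratio lam)
    I0 hs rho0 (tr lam)).
rewrite mul1r ler_pdivrMl ?addr_gt0 //.
apply: (@le_trans _ _ (
  \sum_lam (alpha * f lam (cur (st lam)) + \sum_(x <- OPT lam) rho x))).
  by apply: ler_sum => lam _.
(* The ratios account for [alpha] copies of the value of MULTI; the total cost [rho] accounts for
   the remaining one. *)
rewrite big_split /= -mulr_sumr mulrDl mul1r lerD2l.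
exact: le_trans (sum_disjoint_le hs rho0 Os Odis) sum_rho.
Qed.
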